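(* For any integer $k\ge 1$ there exists a cyclic graph $G_k$ such that $\alpha_{\mathrm{bn}}(G_k)-\Gamma_b(G_k)\ge\alpha_{\mathrm{bnr}}(G_k)-\Gamma_b(G_k)\ge k$.
   Context: All graphs are finite and simple. A cyclic graph is a graph containing a cycle. Let $d(u,v)$ denote distance and $e(v)$ the eccentricity of $v$. A broadcast on a connected graph $G=(V,E)$ is a function $f:V\to\{0,1,\dots,\operatorname{diam}(G)\}$ with $f(v)\le e(v)$ for all $v\in V$ if $|V|\ge 2$, and $f(v)=1$ if $V=\{v\}$. On a disconnected graph, a broadcast is a union of broadcasts on its components. Let $V_f^+=\{v: f(v)>0\}$ and $\sigma(f)=\sum_{v\in V}f(v)$ (the weight). A vertex $u$ hears $f$ from $v\in V_f^+$ (and $v$ dominates $u$) if $d(u,v)\le f(v)$. $f$ is dominating if every vertex hears $f$ from some vertex of $V_f^+$. A dominating broadcast $f$ is minimal dominating if no broadcast $g\neq f$ with $g(v)\le f(v)$ for all $v$ is dominating. $\Gamma_b(G)$ is the maximum weight of a minimal dominating broadcast of $G$. For $v\in V_f^+$ let $N_f(v)=\{u:d(u,v)\le f(v)\}$, $B_f(v)=\{u:d(u,v)=f(v)\}$, and let the private boundary $\operatorname{PB}_f(v)$ be the set of $u\in N_f(v)$ that are not dominated by the function obtained from $f$ by changing the value at $v$ to $f(v)-1$. $f$ is irredundant if $\operatorname{PB}_f(v)\ne\varnothing$ for each $v\in V_f^+$. $f$ is bn-independent if $N_f(u)\cap N_f(v)\subseteq B_f(u)\cap B_f(v)$ for all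 distinct $u,v\in V_f^+$; it is bnr-independent if it is bn-independent and irredundant. $\alpha_{\mathrm{bn}}(G)$ and $\alpha_{\mathrm{bnr}}(G)$ are the maximum weights of a bn-independent and a bnr-independent broadcast on $G$, respectively. *)

(* Defs.v *)
From mathcomp Require Import all_boot all_algebra.

Set Implicit Arguments.
Unset Strict Implicit.
Unset Printing Implicit Defensive.

Record sgraph := SGraph {
  vertex :> finType;
  edge : rel vertex;
  edge_sym : symmetric edge;
  edge_irrefl : irreflexive edge }.

Arguments edge {s} _ _.

Definition cyclic_graph (G : sgraph) : Prop :=
  exists c : seq G, ucycle edge c /\ 2 < size c.

Section Broadcasts.

Variable G : sgraph.
Implicit Types (u v w : G) (f : G -> nat).

Definition component v : {set G} := [set u | connect edge v u].

Definition has_walk u v (n : nat) : bool :=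
  [exists p : n.-tuple G, path edge u p && (last u p == v)].

(* Between vertices of the same component this is the length of a shortest    *)
(* path (see dist_spec).  Between different components, where the distance is *)
(* infinite, it takes the meaningless value #|G|; every use below is guarded  *)
(* by membership in the component.                                            *)
Definition dist u v : nat := find (has_walk u v) (iota 0 #|G|).

Definition ecc v : nat := \max_(u in component v) dist v u.

(* Each component is treated as a graph of its own.  The condition f v <= ecc v *)
(* already puts the values of f in {0, ..., diam} on components with at least   *)
(* two vertices, so the diameter need not be mentioned.                         *)
Definition broadcast f : bool :=
  [forall v, if #|component v| == 1 then f v == 1 else f v <= ecc v].

Definition weight f : nat := \sum_v f v.

Definition Vplus f : {set G} := [set v | 0 < f v].

Definition Nf f v : {set G} := [set u in component v | dist u v <= f v].

Definition Bf f v : {set G} := [set u in component v | dist u v == f v].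

Definition dominated f u : bool := [exists v in Vplus f, u \in Nf f v].

Definition dominating f : bool := [forall u, dominated f u].

(* f with its value at v lowered by one (for f v > 0). *)
Definition decr f v : G -> nat := fun w => f w - (w == v).

Definition PB f v : {set G} := [set u in Nf f v | ~~ dominated (decr f v) u].

Definition irredundant f : bool := [forall v in Vplus f, PB f v != set0].

(* A finite type through which every broadcast factors, by broadcast_le_card: *)
(* quantifying over bounded is the same as quantifying over G -> nat.         *)
Definition bounded : finType := {ffun G -> 'I_#|G|.+1}.

Definition value (g : bounded) : G -> nat := fun v => g v.

Definition minimal_dominating_broadcast f : bool :=
  [&& broadcast f, dominating f &
      [forall g : bounded,
         [&& broadcast (value g), dominating (value g)
           & [forall v, value g v <= f v]]
         ==> [forall v, value g v == f v]]].

Definition bn_independent f : bool :=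
  [forall u in Vplus f, forall v in Vplus f,
     (u != v) ==> (Nf f u :&: Nf f v \subset Bf f u :&: Bf f v)].

Definition bn_independent_broadcast f : bool :=
  broadcast f && bn_independent f.

Definition bnr_independent_broadcast f : bool :=
  [&& broadcast f, bn_independent f & irredundant f].

Definition max_weight (P : (G -> nat) -> bool) : nat :=
  \max_(g : bounded | P (value g)) weight (value g).

Definition Gamma_b : nat := max_weight minimal_dominating_broadcast.
Definition alpha_bn : nat := max_weight bn_independent_broadcast.
Definition alpha_bnr : nat := max_weight bnr_independent_broadcast.

Lemma has_walkP u v n :
  reflect (exists p, [/\ path edge u p, last u p = v & size p = n])
          (has_walk u v n).
Proof.
apply: (iffP existsP) => [[p /andP[pp /eqP lp]]|[p [pp lp sp]]].
  by exists p; rewrite size_tuple.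
by exists (Tuple (introT eqP sp)); rewrite pp lp eqxx.
Qed.

Lemma dist_spec u v : v \in component u ->
  has_walk u v (dist u v) /\ (forall n, has_walk u v n -> dist u v <= n).
Proof.
rewrite inE => /connectP[p0 pp0 lp0].
have [p [pp up lp]] : exists p, [/\ path edge u p, uniq (u :: p) & last u p = v].
  by case/shortenP: pp0 lp0 => p pp up _ lp; exists p.
have szp : size p < #|G| by have := max_card (mem (u :: p)); rewrite (card_uniqP up).
have hp : has_walk u v (size p) by apply/has_walkP; exists p.
have hh : has (has_walk u v) (iota 0 #|G|).
  by apply/hasP; exists (size p); rewrite ?mem_iota.
have dlt : dist u v < #|G| by move: hh; rewrite has_find size_iota.
split; first by have := nth_find 0 hh; rewrite nth_iota.
move=> n hn; rewrite leqNgt; apply/negP => lt_n.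
have := before_find 0 lt_n; rewrite nth_iota ?hn //.
exact: ltn_trans lt_n dlt.
Qed.

Lemma broadcast_le_card f v : broadcast f -> f v <= #|G|.
Proof.
move=> /forallP/(_ v); case: ifP => _.
  by move=> /eqP->; apply/card_gt0P; exists v.
move/leq_trans; apply; apply/bigmax_leqP => u _.
by rewrite -[leqRHS](size_iota 0) find_size.
Qed.

End Broadcasts.

(* Main.v *)
Require Import Defs.
From HB Require Import structures.
From mathcomp Require Import all_boot all_order all_algebra.
From mathcomp Require Import zify.

Set Implicit Arguments.
Unset Strict Implicit.
Unset Printing Implicit Defensive.

(** The graph is a clique on m + 1 vertices, namely a hub and the cores of m
    gadgets.  In each gadget the core, the arm and the fork form a triangle; a
    tip hangs from the arm and two leaves hang from the fork.

    Give every tip the value 2 and every leaf the value 1.  The balls of two of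
    these vertices meet at most in a fork, on both boundaries.  Each leaf is its
    own private vertex, and each tip has its core as private boundary, because
    nothing else reaches the clique.  So this broadcast, of weight 4 m, is
    bnr-independent; but the hub does not hear it.

    A dominating broadcast must reach the hub, and whatever reaches the hub
    reaches all the cores.  This destroys the privacy of the cores in all
    gadgets simultaneously, which costs one unit of weight per gadget.
    Precisely, a minimal dominating broadcast f is irredundant.  Let x maximize
    f x - depth x, where depth is the distance to the core of the gadget.  Then
    x dominates every core, the hub, and every vertex dominated from outside its
    own gadget.  Hence a broadcasting vertex outside the gadget of x must have
    its private vertex inside its own gadget and different from the core.  A
    finite enumeration (locally_irredundant_weight) shows that a gadget carries
    weight at most 3 under this restriction.  The gadget of x and the hub
    contribute at most 35 together, as no value exceeds the diameter 5.  Thus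
    Gamma_b is at most 3 m + 35 (Gamma_b_hub), and m = k + 35 gives the gap k. *)

(** * Recognizing the distance function of a graph *)

(** A function that vanishes on the diagonal, drops by at most one along each
    edge, and drops by exactly one along some edge whenever the two points
    differ, is the distance. *)
Section Distance.

Variables (G : sgraph) (d : G -> G -> nat).
Hypothesis d_refl : forall x, d x x = 0.
Hypothesis d_edge : forall x y z, edge x y -> d x z <= (d y z).+1.
Hypothesis d_step : forall x y, x != y -> exists2 z, edge x z & d x y = (d z y).+1.

Lemma walk_of_length_d x y : has_walk x y (d x y).
Proof.
move dn: (d x y) => n; elim: n x dn => [|n IHn] x dn.
  apply/has_walkP; exists [::]; split=> //=; apply/eqP; apply: contraPT dn.
  by case/d_step=> z _ ->.
have /d_step[z xz dz] : x != y by apply: contra_eqN dn => /eqP->; rewrite d_refl.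
have /IHn/has_walkP[p [zp pl sp]] : d z y = n by apply: succn_inj; rewrite -dz.
by apply/has_walkP; exists (z :: p); rewrite /= xz zp pl sp.
Qed.

Lemma d_le_walk x y n : has_walk x y n -> d x y <= n.
Proof.
case/has_walkP=> p [pp <- <-] {y n}; elim: p x pp => [|z p IHp] x /=.
  by rewrite d_refl.
by case/andP=> xz /IHp zy; apply: leq_trans (d_edge _ xz) _.
Qed.

Lemma d_component x y : y \in component (x : G).
Proof.
rewrite inE; apply/connectP.
by have /has_walkP[p [pp pl _]] := walk_of_length_d x y; exists p.
Qed.

Lemma dist_eq_d x y : dist x y = d x y.
Proof.
have [walk_dist dist_min] := dist_spec (d_component x y).
by apply/eqP; rewrite eqn_leq d_le_walk ?dist_min ?walk_of_length_d.
Qed.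

End Distance.

(** * Extremal broadcasts *)

Section Irredundance.

Variable G : sgraph.
Implicit Types (u v : G) (f g : G -> nat).

Lemma eq_broadcast f g : f =1 g -> broadcast f = broadcast g.
Proof. by move=> fg; apply: eq_forallb => v; rewrite fg. Qed.

Lemma eq_Vplus f g : f =1 g -> Vplus f = Vplus g.
Proof. by move=> fg; apply/setP => v; rewrite !inE fg. Qed.

Lemma eq_Nf f g : f =1 g -> Nf f =1 Nf g.
Proof. by move=> fg v; apply/setP => u; rewrite !inE fg. Qed.

Lemma eq_Bf f g : f =1 g -> Bf f =1 Bf g.
Proof. by move=> fg v; apply/setP => u; rewrite !inE fg. Qed.

Lemma eq_dominated f g : f =1 g -> dominated f =1 dominated g.
Proof.
by move=> fg u; rewrite /dominated (eq_Vplus fg); apply: eq_existsb => v;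
  rewrite (eq_Nf fg).
Qed.

Lemma eq_dominating f g : f =1 g -> dominating f = dominating g.
Proof. by move=> fg; apply: eq_forallb => u; rewrite (eq_dominated fg). Qed.

Lemma eq_bn_independent f g : f =1 g -> bn_independent f = bn_independent g.
Proof.
move=> fg; rewrite /bn_independent (eq_Vplus fg).
apply: eq_forallb => u; congr (_ ==> _); apply: eq_forallb => v.
by rewrite !(eq_Nf fg) !(eq_Bf fg).
Qed.

Lemma eq_irredundant f g : f =1 g -> irredundant f = irredundant g.
Proof.
move=> fg; rewrite /irredundant (eq_Vplus fg); apply: eq_forallb => v.
have decr_fg : decr f v =1 decr g v by move=> u; rewrite /decr fg.
suff -> : PB f v = PB g v by [].
by apply/setP => u; rewrite !inE fg (eq_dominated decr_fg).
Qed.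

Definition tabulate f : bounded G := [ffun v => inord (f v)].

Lemma value_tabulate f : broadcast f -> value (tabulate f) =1 f.
Proof.
by move=> bf v; rewrite /value ffunE inordK // ltnS broadcast_le_card.
Qed.

Lemma weight_le_max (P : (G -> nat) -> bool) (g : bounded G) :
  P (value g) -> weight (value g) <= max_weight P.
Proof.
move=> Pg; exact: (@leq_bigmax_cond _ (fun h : bounded G => P (value h))
  (fun h => weight (value h)) g Pg).
Qed.

Lemma weight_le_alpha_bnr f : bnr_independent_broadcast f ->
  weight f <= alpha_bnr G.
Proof.
move=> /and3P[bf indf irrf]; have gf := value_tabulate bf.
have -> : weight f = weight (value (tabulate f)).
  by apply: eq_bigr => v _; rewrite gf.
apply: weight_le_max.
by rewrite /bnr_independent_broadcast (eq_broadcast gf) (eq_bn_independent gf)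
  (eq_irredundant gf) bf indf.
Qed.

(** If the private boundary of v is empty, lowering f by one at v keeps it
    dominating.  On a one-vertex component the lowered function would not be a
    broadcast, hence the hypothesis on components. *)
Lemma minimal_dominating_irredundant f :
    (forall v, #|component v| != 1) ->
  minimal_dominating_broadcast f -> irredundant f.
Proof.
move=> nontriv /and3P[bf df /forallP minf].
apply/forall_inP => v; rewrite inE => fv_gt0.
have decr_le u : decr f v u <= f u by apply: leq_subr.
have bdecr : broadcast (decr f v).
  apply/forallP => u; rewrite (negPf (nontriv u)).
  have /forallP/(_ u) := bf; rewrite (negPf (nontriv u)).
  exact: leq_trans (decr_le u).
have gE := value_tabulate bdecr.
have /negP/forallPn[u undom] : ~ dominating (decr f v).
  move=> ddecr; have /implyP := minf (tabulate (decr f v)).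
  rewrite (eq_broadcast gE) (eq_dominating gE) bdecr ddecr /=.
  have -> : [forall u, value (tabulate (decr f v)) u <= f u].
    by apply/forallP => u; rewrite gE.
  move=> /(_ isT)/forallP/(_ v); rewrite gE /decr eqxx; lia.
apply/set0Pn; exists u; rewrite !inE undom andbT.
have /forallP/(_ u)/exists_inP[v' fv' uv'] := df.
have [eqv|neqv] := eqVneq v' v; first by move: uv'; rewrite eqv !inE.
case/negP: undom; apply/exists_inP; exists v'.
  by move: fv'; rewrite !inE /decr (negPf neqv) subn0.
by move: uv'; rewrite !inE /decr (negPf neqv) subn0.
Qed.

Lemma alpha_bnr_le_bn : alpha_bnr G <= alpha_bn G.
Proof.
apply/bigmax_leqP => h /and3P[bh ih _].
by apply: weight_le_max; apply/andP.
Qed.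

End Irredundance.

(** * One gadget *)

Inductive part := Core | Arm | Tip | Fork | Leaf1 | Leaf2.

Definition parts := [:: Core; Arm; Tip; Fork; Leaf1; Leaf2].

Definition part_code p :=
  match p with
  | Core => 0 | Arm => 1 | Tip => 2 | Fork => 3 | Leaf1 => 4 | Leaf2 => 5
  end.

Lemma part_codeK : cancel part_code (nth Core parts).
Proof. by case. Qed.

HB.instance Definition _ := Countable.copy part (can_type part_codeK).

Lemma parts_enum : Finite.axiom parts.
Proof. by case. Qed.

HB.instance Definition _ := isFinite.Build part parts_enum.

(** The distance matrix of the graph with edges Core-Arm, Core-Fork, Arm-Fork,
    Arm-Tip, Fork-Leaf1 and Fork-Leaf2, with rows and columns in the order of
    parts. *)
Definition pdist p q : nat :=
  nth 0 (nth [::]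
   [:: [:: 0; 1; 2; 1; 2; 2];
       [:: 1; 0; 1; 1; 2; 2];
       [:: 2; 1; 0; 2; 3; 3];
       [:: 1; 1; 2; 0; 1; 1];
       [:: 2; 2; 3; 1; 0; 2];
       [:: 2; 2; 3; 1; 2; 0]] (part_code p)) (part_code q).

Lemma pdistC p q : pdist p q = pdist q p.
Proof. by case: p; case: q. Qed.

Lemma pdist0 p : pdist p p = 0.
Proof. by case: p. Qed.

Lemma pdist_triangle p q r : pdist p r <= pdist p q + pdist q r.
Proof. by case: p; case: q; case: r. Qed.

Lemma pdist_step p q : p != q ->
  exists2 r, pdist p r == 1 & pdist p q = (pdist r q).+1.
Proof.
by case: p; case: q => // _;
  first [by exists Core | by exists Arm | by exists Fork
        | by exists Tip | by exists Leaf1 | by exists Leaf2].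
Qed.

Lemma pdist_le3 p q : pdist p q <= 3.
Proof. by case: p; case: q. Qed.

Lemma depth_le2 p : pdist p Core <= 2.
Proof. by case: p. Qed.

Lemma mem_parts p : p \in parts.
Proof. by case: p. Qed.

Lemma sum_parts (F : part -> nat) : \sum_p F p = sumn (map F parts).
Proof.
rewrite sumnE big_map [RHS]big_uniq //=.
by apply: eq_bigl => p; rewrite mem_parts.
Qed.

(** The second bound says that q hears p at distance exactly F p, unless
    F p = 1, when p may also be its own private vertex. *)
Definition privately_reaches (F : part -> nat) p q :=
  [&& pdist q p <= F p, F p <= maxn (pdist q p) 1 &
      all (fun r => [|| r == p, F r == 0 | F r < pdist q r]) parts].

(** Private vertices are sought in behead parts, which leaves out Core: in the
    graph below the cores of almost all gadgets are dominated from elsewhere. *)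
Definition locally_irredundant F :=
  all (fun p => (F p == 0) || has (privately_reaches F p) (behead parts)) parts.

Definition assignments :=
  iter 6 (fun ss => [seq x :: s | x <- iota 0 4, s <- ss]) [:: [::]].

Lemma mem_assignments (F : part -> nat) :
  (forall p, F p <= 3) -> map F parts \in assignments.
Proof.
move=> F_le3; have cons_in x s ss : x <= 3 -> s \in ss ->
    x :: s \in [seq x :: s | x <- iota 0 4, s <- ss].
  by move=> x_le3 s_in; apply/allpairsP; exists (x, s); rewrite mem_iota.
by rewrite /assignments [map F parts]/=; do 6![apply: (cons_in) => //].
Qed.

(** With the core admitted as a private vertex, 4 would be possible: 2 on the
    tip and 1 on each leaf.  The values are at most 3, the diameter of a gadget,
    so there are 4 ^ 6 cases, checked by computation. *)
Lemma locally_irredundant_weight F : locally_irredundant F -> \sum_p F p <= 3.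
Proof.
move=> irrF; have F_le3 p : F p <= 3.
  have /allP/(_ p (mem_parts p))/orP[/eqP-> //|] := irrF.
  case/hasP=> q _ /and3P[_ Fp _]; apply: leq_trans Fp _.
  by rewrite geq_max pdist_le3.
have enumerated : all (fun s =>
    locally_irredundant (fun p => nth 0 s (part_code p)) ==> (sumn s <= 3))
    assignments.
  by vm_compute.
have /implyP := allP enumerated _ (mem_assignments F_le3).
by rewrite sum_parts; apply.
Qed.

(** * The graph: gadgets whose cores form a clique with a hub *)

Section HubGraph.

Variable m : nat.
Local Notation vertex := (option ('I_m * part)).
Implicit Types (w x y z : vertex) (i : 'I_m) (p q : part).

Definition gadget x : option 'I_m := omap fst x.
(** The hub None counts as a gadget consisting of a core only. *)
Definition role x : part := if x is Some (_, p) then p else Core.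
Definition depth x : nat := pdist (role x) Core.

(** A shortest path between two gadgets passes through both cores. *)
Definition hdist x y : nat :=
  if gadget x == gadget y then pdist (role x) (role y)
  else (depth x + depth y).+1.

Definition hub_edge : rel vertex := fun x y => hdist x y == 1.

Lemma hdistC x y : hdist x y = hdist y x.
Proof. by rewrite /hdist eq_sym pdistC addnC. Qed.

Lemma hdist0 x : hdist x x = 0.
Proof. by rewrite /hdist eqxx pdist0. Qed.

Lemma hub_edge_sym : symmetric hub_edge.
Proof. by move=> x y; rewrite /hub_edge hdistC. Qed.

Lemma hub_edge_irrefl : irreflexive hub_edge.
Proof. by move=> x; rewrite /hub_edge hdist0. Qed.

Definition hub_graph : sgraph := SGraph hub_edge_sym hub_edge_irrefl.

(** Valid also inside a gadget, where the walk through the core is merely not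
    optimal; so one bound on f x controls the whole graph. *)
Lemma hdist_le_depths x y : hdist x y <= (depth x + depth y).+1.
Proof.
rewrite /hdist; case: eqP => // _; rewrite /depth (pdistC (role y)).
by rewrite leqW ?pdist_triangle.
Qed.

Lemma hdist_triangle x y z : hdist x z <= hdist x y + hdist y z.
Proof.
rewrite /hdist /depth.
have := pdist_triangle (role x) (role y) (role z).
have := pdist_triangle (role x) Core (role z).
have := pdist_triangle (role x) (role y) Core.
have := pdist_triangle (role z) (role y) Core.
rewrite (pdistC Core (role z)) (pdistC (role z) (role y)).
case: (eqVneq (gadget x) (gadget y)) => [->|xy] //;
  case: (eqVneq (gadget y) (gadget z)) => [yz|yz];
  rewrite -?yz ?(negPf xy) ?(negPf yz) ?eqxx //; try (case: ifP => _); lia.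
Qed.

Lemma eq_gadget_role x y : gadget x = gadget y -> role x = role y -> x = y.
Proof. by case: x => [[i p]|]; case: y => [[j q]|] //= [->] ->. Qed.

Definition same_gadget x p : vertex := omap (fun ip => (ip.1, p)) x.

Lemma hdist_step x y : x != y ->
  exists2 z, hub_edge x z & hdist x y = (hdist z y).+1.
Proof.
move=> neq_xy; have step_in p : pdist (role x) p = 1 -> x != None ->
    hdist x (same_gadget x p) = 1 /\ role (same_gadget x p) = p /\
    gadget (same_gadget x p) = gadget x.
  by case: x {neq_xy} => [[i q]|] //= qp _; rewrite /hdist /= eqxx qp.
have [eqg|neqg] := eqVneq (gadget x) (gadget y).
  have [|p xp py] := @pdist_step (role x) (role y).
    by apply: contra_neq neq_xy => /(eq_gadget_role eqg).
  have [||xz [rz gz]] := step_in p; first exact/eqP.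
    by apply: contra_neq neq_xy => x0; move: eqg; rewrite x0; case: (y) => [[]|].
  exists (same_gadget x p); first exact/eqP.
  by rewrite /hdist gz rz eqg eqxx.
have [core_x|ncore_x] := eqVneq (role x) Core.
  have [gz rz] : gadget (same_gadget y Core) = gadget y /\
      role (same_gadget y Core) = Core by case: (y) => [[]|].
  exists (same_gadget y Core).
    by rewrite /hub_edge /hdist gz (negPf neqg) /depth core_x rz.
  by rewrite /hdist gz rz eqxx (negPf neqg) /depth core_x pdistC.
have [p xp pc] := pdist_step ncore_x.
have [||xz [rz gz]] := step_in p; first exact/eqP.
  by apply: contra_neq ncore_x => ->.
exists (same_gadget x p); first exact/eqP.
by rewrite /hdist gz (negPf neqg) /depth rz pc.
Qed.

Lemma hub_edge_le x y z : hub_edge x y -> hdist x z <= (hdist y z).+1.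
Proof. by move=> /eqP xy; have := hdist_triangle x y z; rewrite xy. Qed.

Lemma dist_hub (x y : hub_graph) : dist x y = hdist x y.
Proof. exact: (@dist_eq_d hub_graph hdist hdist0 hub_edge_le hdist_step). Qed.

Lemma component_hub (x y : hub_graph) : y \in component x.
Proof. exact: (@d_component hub_graph hdist hdist0 hdist_step). Qed.

Lemma mem_Nf_hub (f : hub_graph -> nat) x y : (x \in Nf f y) = (hdist x y <= f y).
Proof. by rewrite inE component_hub dist_hub. Qed.

Lemma mem_Bf_hub (f : hub_graph -> nat) x y : (x \in Bf f y) = (hdist x y == f y).
Proof. by rewrite inE component_hub dist_hub. Qed.

Lemma hdist_le5 x y : hdist x y <= 5.
Proof.
apply: leq_trans (hdist_le_depths x y) _.
by have := depth_le2 (role x); have := depth_le2 (role y); rewrite /depth; lia.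
Qed.

(** * The upper bound on minimal dominating broadcasts *)

(** A vertex that no longer hears y after f y drops by one lies on the sphere of
    radius f y, except when f y = 1: then y stops broadcasting altogether and
    may itself be the private vertex. *)
Lemma private_vertex (f : hub_graph -> nat) y : irredundant f -> 0 < f y ->
  exists w, [/\ hdist w y <= f y, f y <= maxn (hdist w y) 1 &
                forall z, z != y -> 0 < f z -> f z < hdist w z].
Proof.
move=> /forall_inP irrf fy; have /set0Pn[w] : PB f y != set0.
  by apply: irrf; rewrite inE.
rewrite inE mem_Nf_hub => /andP[wy undom]; exists w.
have hears z : 0 < decr f y z -> decr f y z < hdist w z.
  move=> fz; rewrite ltnNge; apply: contra undom => wz.
  by apply/exists_inP; exists z; [rewrite inE | rewrite mem_Nf_hub].
split=> // [|z zy fz]; last first.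
  by have := hears z; rewrite /decr (negPf zy) subn0; apply.
by have := hears y; rewrite /decr eqxx; lia.
Qed.

Lemma sum_hub (f : hub_graph -> nat) :
  weight f = f None + \sum_i \sum_p f (Some (i, p)).
Proof.
rewrite /weight; pose F (x : vertex) := f x.
have -> : \sum_v f v = \sum_(x : vertex) F x by [].
rewrite (bigD1 None) //=; congr (_ + _).
rewrite (reindex_omap Some id) /=; last by case.
rewrite pair_big; apply: eq_big => [[i p]|[i p] _] //=.
by rewrite eqxx.
Qed.

(** The vertex x whose ball extends furthest past the core of its gadget dominates
    all that any ball reaches across the clique, so privacy survives only
    inside single gadgets, away from their cores. *)
Lemma irredundant_dominating_weight (f : hub_graph -> nat) :
  irredundant f -> dominating f -> weight f <= 3 * m + 35.
Proof.
move=> irrf domf; have f_le5 y : f y <= 5.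
  have [->//|fy] := posnP (f y).
  have [w [_ le_fy _]] := private_vertex irrf fy.
  by apply: leq_trans le_fy _; rewrite geq_max hdist_le5.
(* Whatever dominates the hub also reaches past the core of its own gadget. *)
have [y0 fy0 deep_y0] : exists2 y, 0 < f y & depth y < f y.
  have /forallP/(_ None)/exists_inP[y] := domf.
  rewrite inE mem_Nf_hub => fy hears; exists y => //.
  by case: y fy hears => [[i p]|].
have [x _ x_max] := @arg_maxnP _ (None : vertex) xpredT (fun y => f y - depth y) isT.
have deep_x : depth x < f x by have := x_max y0 isT; lia.
have covered y w : 0 < f y -> hdist w y <= f y ->
    (gadget w != gadget y) || (role w == Core) -> hdist w x <= f x.
  move=> fy wy outside; apply: leq_trans (hdist_le_depths w x) _.
  case/orP: outside => [neqg|/eqP core_w]; last by rewrite {1}/depth core_w.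
  by move: wy (x_max y isT); rewrite /hdist (negPf neqg); lia.
have local_irr i : Some i != gadget x ->
    locally_irredundant (fun p => f (Some (i, p))).
  move=> ix; apply/allP => p _; apply/orP.
  have [|fp] := posnP (f (Some (i, p))); [by left | right; apply/hasP].
  have [w [qp le_f priv]] := private_vertex irrf fp.
  have xp : x != Some (i, p) by apply: contra_neq ix => ->.
  have inside : ~~ ((gadget w != Some i) || (role w == Core)).
    apply/negP => /(covered _ _ fp qp); rewrite leqNgt.
    by rewrite priv // (leq_ltn_trans _ deep_x).
  case: w qp le_f priv inside => [[j q]|] //= qp le_f priv.
  rewrite negb_or negbK => /andP[/eqP[ji]] q_core; rewrite {j}ji in qp le_f priv.
  have hE r : hdist (Some (i, q)) (Some (i, r)) = pdist q r.
    by rewrite /hdist eqxx.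
  exists q; first by case: (q) q_core.
  rewrite hE in qp le_f; apply/and3P; split=> //; apply/allP => r _.
  have [//|neq_rp] := eqVneq r p; have [//|fr] /= := posnP (f (Some (i, r))).
  by rewrite -hE priv //; apply: contra_neq neq_rp => -[].
have gadget_weight i : \sum_p f (Some (i, p)) <= 3 + 27 * (Some i == gadget x).
  have [_|ix] := eqVneq; last exact: locally_irredundant_weight (local_irr i ix).
  (* 30 = 3 + 27: six vertices of value at most 5. *)
  have -> : 3 + 27 * true = \sum_(p : part) 5 by rewrite sum_parts.
  exact: leq_sum.
have one_gadget : \sum_i (Some i == gadget x) <= 1.
  case: (gadget x) => [j|]; last by rewrite big1.
  rewrite (bigD1 j) //= eqxx big1 // => i ij.
  by rewrite (inj_eq Some_inj) (negPf ij).
have : \sum_i \sum_p f (Some (i, p)) <= \sum_i (3 + 27 * (Some i == gadget x)).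
  exact: leq_sum.
rewrite sum_hub big_split /= sum_nat_const card_ord -big_distrr /=.
move: (f_le5 None) one_gadget.
move: (f None) (\sum_i \sum_p _) (\sum_i (_ : nat)) => f0 S T; lia.
Qed.

Lemma component_hub_card (x : hub_graph) : 0 < m -> #|component x| != 1.
Proof.
move=> m_gt0; have -> : component x = [set: hub_graph].
  by apply/setP => y; rewrite component_hub inE.
rewrite cardsT; have -> : #|hub_graph| = #|{: vertex}| by [].
rewrite card_option card_prod card_ord eqSS muln_eq0 negb_or -lt0n m_gt0 /=.
by rewrite -lt0n; apply/card_gt0P; exists Core.
Qed.

Lemma Gamma_b_hub : 0 < m -> Gamma_b hub_graph <= 3 * m + 35.
Proof.
move=> m_gt0; apply/bigmax_leqP => g min_g.
have /and3P[_ dom_g _] := min_g.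
apply: irredundant_dominating_weight dom_g.
apply: minimal_dominating_irredundant min_g => x.
exact: component_hub_card.
Qed.

(** * A heavy bnr-independent broadcast that misses the hub *)

Definition charge p : nat :=
  match p with Tip => 2 | Leaf1 | Leaf2 => 1 | _ => 0 end.

Definition tips_and_leaves (x : hub_graph) : nat :=
  if x is Some (_, p) then charge p else 0.

Lemma weight_tips_and_leaves : weight tips_and_leaves = 4 * m.
Proof.
rewrite sum_hub add0n.
rewrite (eq_bigr (fun=> 4)); last by move=> i _; rewrite sum_parts.
by rewrite sum_nat_const card_ord mulnC.
Qed.

(** A tip is at distance 2 from its core and a leaf of value 1 does not even
    reach it, so no ball leaves its gadget. *)
Lemma charge_local x i p : 0 < charge p -> hdist x (Some (i, p)) <= charge p ->
  exists q, x = Some (i, q).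
Proof.
case: x => [[j q]|]; last by case: p.
rewrite /hdist /=; case: eqVneq => [[->]|_]; first by exists q.
by rewrite /depth; case: p; case: q.
Qed.

Lemma broadcast_tips_and_leaves : 0 < m -> broadcast tips_and_leaves.
Proof.
move=> m_gt0; apply/forallP => x; rewrite (negPf (component_hub_card x m_gt0)).
have core_in : (same_gadget x Core : hub_graph) \in component x.
  exact: component_hub.
apply: leq_trans (leq_bigmax_cond _ core_in); rewrite dist_hub /hdist.
by case: x {core_in} => [[i p]|] //=; rewrite eqxx; case: p.
Qed.

Lemma bn_independent_tips_and_leaves : bn_independent tips_and_leaves.
Proof.
apply/forall_inP => -[[i p]|]; rewrite inE //= => p_gt0.
apply/forall_inP => -[[j q]|]; rewrite inE //= => q_gt0.
apply/implyP => neq; apply/subsetP => x.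
rewrite !in_setI !mem_Nf_hub !mem_Bf_hub /= => /andP[xp xq].
have [r xE] := charge_local p_gt0 xp; subst x.
have [r' [ij rr']] := charge_local q_gt0 xq; subst j r'.
have {neq} : p != q by apply: contra_neq neq => ->.
move: p_gt0 q_gt0 xp xq; rewrite /hdist /= eqxx.
by case: p => //; case: q => //; case: r.
Qed.

Lemma irredundant_tips_and_leaves : irredundant tips_and_leaves.
Proof.
apply/forall_inP => -[[i p]|]; rewrite inE //= => p_gt0.
(* The private vertex of a tip is its core; a leaf is its own. *)
pose q := if p is Tip then Core else p; apply/set0Pn; exists (Some (i, q)).
rewrite inE mem_Nf_hub; apply/andP; split.
  by rewrite /hdist eqxx /q; case: (p) p_gt0.
apply/negP => /exists_inP[z]; rewrite inE mem_Nf_hub => z_gt0 qz.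
have decr_le : decr tips_and_leaves (Some (i, p)) z <= tips_and_leaves z.
  exact: leq_subr.
have := leq_trans qz decr_le; have := leq_trans z_gt0 decr_le.
case: z z_gt0 qz {decr_le} => [[j r]|] //= z_gt0 qz r_gt0.
case/(charge_local r_gt0)=> q' [ij _]; subst j.
move: z_gt0 qz; rewrite /decr /hdist /= eqxx (inj_eq Some_inj) xpair_eqE eqxx /=.
by rewrite /q; case: (p) p_gt0 => //; case: r r_gt0.
Qed.

End HubGraph.

Theorem theorem4p9 (k : nat) (hk : (1 <= k)%N) :
  exists G : sgraph,
    cyclic_graph G /\
    ((alpha_bn G)%:Z - (Gamma_b G)%:Z >= (alpha_bnr G)%:Z - (Gamma_b G)%:Z)%R /\
    ((alpha_bnr G)%:Z - (Gamma_b G)%:Z >= k%:Z)%R.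
Proof.
pose m := k + 35; have m_gt0 : 0 < m by rewrite addn_gt0 orbT.
exists (hub_graph m); split.
  exists [seq Some (Ordinal m_gt0, p) | p <- [:: Core; Arm; Fork]].
  by rewrite /ucycle /= /hub_edge /hdist /=.
have bnr_le_bn := alpha_bnr_le_bn (hub_graph m).
have Gamma_le := Gamma_b_hub m_gt0.
have bnr_ge : 4 * m <= alpha_bnr (hub_graph m).
  rewrite -weight_tips_and_leaves; apply: weight_le_alpha_bnr; apply/and3P; split.
  - exact: broadcast_tips_and_leaves.
  - exact: bn_independent_tips_and_leaves.
  - exact: irredundant_tips_and_leaves.
by split; lia.
Qed.
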